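(* The logic $\mathrm{ILM}$ is an extension of the logic $\mathrm{JP'}$; that is, every formula of $\mathrm{JP'}$ is a formula of $\mathrm{ILM}$, and for every formula $\alpha$ of $\mathrm{JP'}$, $\vdash_{\mathrm{JP'}}\alpha$ if and only if $\vdash_{\mathrm{ILM}}\alpha$.
   Context: A logic $\mathrm{L'}$ with set of formulas $F'$ is called an extension of a logic $\mathrm{L}$ with set of formulas $F$ if $F\subseteq F'$ and for all $\alpha\in F$: $\vdash_{\mathrm{L}}\alpha$ iff $\vdash_{\mathrm{L'}}\alpha$. Formulas of $\mathrm{ILM}$ are built from propositional variables and constants $\top,\bot$ with $\wedge,\vee,\rightarrow,\neg,\sim$; $\alpha\leftrightarrow\beta$ abbreviates $(\alpha\rightarrow\beta)\wedge(\beta\rightarrow\alpha)$. Its axiom schemes are: (A1) $\alpha\rightarrow(\beta\rightarrow\alpha)$; (A2) $(\alpha\rightarrow(\beta\rightarrow\gamma))\rightarrow((\alpha\rightarrow\beta)\rightarrow(\alpha\rightarrow\gamma))$; (A3) $\alpha\rightarrow(\alpha\vee\beta)$, $\beta\rightarrow(\alpha\vee\beta)$; (A4) $(\alpha\rightarrow\gamma)\rightarrow((\beta\rightarrow\gamma)\rightarrow((\alpha\vee\beta)\rightarrow\gamma))$; (A5) $(\alpha\wedge\beta)\rightarrow\alpha$, $(\alpha\wedge\beta)\rightarrow\beta$; (A6) $(\alpha\rightarrow\beta)\rightarrow((\alpha\rightarrow\gamma)\rightarrow(\alpha\rightarrow(\beta\wedge\gamma)))$; (A7) $\alpha\rightarrow\top$;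 (A8) $\bot\rightarrow\alpha$; (A9) $(\alpha\rightarrow\beta)\rightarrow((\alpha\rightarrow\neg\beta)\rightarrow\neg\alpha)$; (A10) $\neg\alpha\rightarrow(\alpha\rightarrow\beta)$; (A11) $\sim\alpha\leftrightarrow(\alpha\rightarrow\neg\neg\sim\top)$. Modus ponens is the only rule. Formulas of $\mathrm{JP'}$ are built from propositional variables and the constant $\top$ with $\vee,\wedge,\rightarrow,\sim$. Its axiom schemes are (A1)–(A7), (A13) $(\alpha\rightarrow\beta)\rightarrow((\alpha\rightarrow\sim\beta)\rightarrow\sim\alpha)$, and (P$'$) $\sim\sim(\sim\top\rightarrow\beta)$. Modus ponens is the only rule. *)

(* Defs.v *)
(* A single syntax carries the signatures of all the logics involved, so that
   the inclusion between two sets of formulas is a genuine inclusion. *)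
Inductive form : Type :=
  | Var (n : nat)
  | Top
  | Bot
  | And (a b : form)
  | Or (a b : form)
  | Imp (a b : form)
  | Neg (a : form)
  | Sim (a : form).

Declare Scope form_scope.
Delimit Scope form_scope with form.
Bind Scope form_scope with form.

Notation "⊤" := Top : form_scope.
Notation "⊥" := Bot : form_scope.
Notation "¬ a" := (Neg a) (at level 35, right associativity) : form_scope.
Notation "∼ a" := (Sim a) (at level 35, right associativity) : form_scope.
Notation "a ∧ b" := (And a b) (at level 40, left associativity) : form_scope.
Notation "a ∨ b" := (Or a b) (at level 50, left associativity) : form_scope.
Notation "a ⇒ b" := (Imp a b) (at level 55, right associativity) : form_scope.
Notation "a ⇔ b" := (And (Imp a b) (Imp b a))
  (at level 56, no associativity) : form_scope.

Local Open Scope form_scope.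

Record logic : Type := Logic {
  formula : form -> Prop;
  scheme : form -> Prop
}.

(* Only those instances of the schemes that are formulas of [L] are axioms of
   [L].  For the logics below, whose sets of formulas are closed under
   subformulas, this makes the schematic letters range over the formulas of [L]
   and keeps every formula of a derivation in the language of [L]. *)
Inductive provable (L : logic) : form -> Prop :=
  | prov_ax a : formula L a -> scheme L a -> provable L a
  | prov_mp a b : provable L a -> provable L (a ⇒ b) -> provable L b.

Definition is_extension_of (L' L : logic) : Prop :=
  (forall a, formula L a -> formula L' a) /\
  (forall a, formula L a -> (provable L a <-> provable L' a)).

Inductive positive_scheme : form -> Prop :=
  | A1 a b : positive_scheme (a ⇒ (b ⇒ a))
  | A2 a b c : positive_scheme ((a ⇒ (b ⇒ c)) ⇒ ((a ⇒ b) ⇒ (a ⇒ c)))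
  | A3l a b : positive_scheme (a ⇒ (a ∨ b))
  | A3r a b : positive_scheme (b ⇒ (a ∨ b))
  | A4 a b c : positive_scheme ((a ⇒ c) ⇒ ((b ⇒ c) ⇒ ((a ∨ b) ⇒ c)))
  | A5l a b : positive_scheme ((a ∧ b) ⇒ a)
  | A5r a b : positive_scheme ((a ∧ b) ⇒ b)
  | A6 a b c : positive_scheme ((a ⇒ b) ⇒ ((a ⇒ c) ⇒ (a ⇒ (b ∧ c))))
  | A7 a : positive_scheme (a ⇒ ⊤).

Inductive ILM_scheme : form -> Prop :=
  | ILM_pos a : positive_scheme a -> ILM_scheme a
  | A8 a : ILM_scheme (⊥ ⇒ a)
  | A9 a b : ILM_scheme ((a ⇒ b) ⇒ ((a ⇒ ¬ b) ⇒ ¬ a))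
  | A10 a b : ILM_scheme (¬ a ⇒ (a ⇒ b))
  | A11 a : ILM_scheme (∼ a ⇔ (a ⇒ ¬ ¬ ∼ ⊤)).

Definition ILM_formula (a : form) : Prop := True.

Definition ILM : logic := Logic ILM_formula ILM_scheme.

Inductive JP'_scheme : form -> Prop :=
  | JP'_pos a : positive_scheme a -> JP'_scheme a
  | A13 a b : JP'_scheme ((a ⇒ b) ⇒ ((a ⇒ ∼ b) ⇒ ∼ a))
  | P' b : JP'_scheme (∼ ∼ (∼ ⊤ ⇒ b)).

Inductive JP'_formula : form -> Prop :=
  | JP'_Var n : JP'_formula (Var n)
  | JP'_Top : JP'_formula ⊤
  | JP'_And a b : JP'_formula a -> JP'_formula b -> JP'_formula (a ∧ b)
  | JP'_Or a b : JP'_formula a -> JP'_formula b -> JP'_formula (a ∨ b)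
  | JP'_Imp a b : JP'_formula a -> JP'_formula b -> JP'_formula (a ⇒ b)
  | JP'_Sim a : JP'_formula a -> JP'_formula (∼ a).

Definition JP' : logic := Logic JP'_formula JP'_scheme.

(* Main.v *)
(* In both logics [∼ a] is equivalent to [a ⇒ ∼⊤].  Under this reading ILM adds
   to positive logic a constant [∼⊤] with [¬¬∼⊤ ⇒ ∼⊤], while JP' adds the law
   [((∼⊤ ⇒ b) ⇒ ∼⊤) ⇒ ∼⊤] for all [b]; ILM obviously proves the latter.

   For conservativity, replace [⊥] in an ILM-derivation of a JP'-formula by the
   conjunction of [∼⊤] with the first [N] variables, [¬ a] by [a ⇒ that
   conjunction], and every other variable by [⊤].  The conjunction implies every
   translated formula, and stability of [∼⊤] with respect to it follows from (P')
   because it implies [∼⊤].  For [N] large the JP'-formula is left unchanged. *)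
From Stdlib Require Import List PeanoNat Lia.
Import ListNotations.
Require Import Defs.

Local Open Scope form_scope.

(** * Hilbert-style deduction over positive logic *)

(** Axiom instances must be formulas of [L], so each step of the deduction theorem has to recover
    that the parts of a derived formula are formulas too; hence the equivalences rather than mere
    closure. *)
Record positive_logic (L : logic) : Prop := {
  formula_Top : formula L ⊤;
  formula_And a b : formula L (a ∧ b) <-> formula L a /\ formula L b;
  formula_Or a b : formula L (a ∨ b) <-> formula L a /\ formula L b;
  formula_Imp a b : formula L (a ⇒ b) <-> formula L a /\ formula L b;
  scheme_positive a : positive_scheme a -> scheme L a
}.

Inductive derives (L : logic) (Γ : list form) : form -> Prop :=
  | d_hyp a : In a Γ -> formula L a -> derives L Γ a
  | d_ax a : formula L a -> scheme L a -> derives L Γ a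
  | d_mp a b : derives L Γ a -> derives L Γ (a ⇒ b) -> derives L Γ b.

Lemma derives_nil L a : derives L [] a -> provable L a.
Proof.
  induction 1 as [a []|a Fa Sa|a b _ IHa _ IHab].
  - now apply prov_ax.
  - now apply prov_mp with a.
Qed.

Lemma derives_weaken L Γ Δ a : incl Γ Δ -> derives L Γ a -> derives L Δ a.
Proof.
  intros inc; induction 1 as [a Ha Fa|a Fa Sa|a b _ IHa _ IHab].
  - apply d_hyp; auto.
  - now apply d_ax.
  - now apply d_mp with a.
Qed.

Section PositiveLogic.

Variables (L : logic) (PL : positive_logic L).

Lemma derives_formula Γ a : derives L Γ a -> formula L a.
Proof.
  induction 1 as [a Ha Fa|a Fa Sa|a b _ _ _ Fab]; trivial.
  now apply (formula_Imp L PL) in Fab.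
Qed.

Lemma derives_positive Γ a :
  formula L a -> positive_scheme a -> derives L Γ a.
Proof. intros Fa Sa; apply d_ax; [|apply (scheme_positive L PL)]; trivial. Qed.

Local Ltac form_tac :=
  repeat rewrite ?(formula_And L PL), ?(formula_Or L PL), ?(formula_Imp L PL) in *;
  tauto.

Lemma derives_const Γ a b : formula L a -> derives L Γ b -> derives L Γ (a ⇒ b).
Proof.
  intros Fa db; pose proof (derives_formula _ _ db) as Fb.
  apply d_mp with b; trivial.
  apply derives_positive; [form_tac | constructor].
Qed.

Lemma derives_refl Γ a : formula L a -> derives L Γ (a ⇒ a).
Proof.
  intros Fa; apply d_mp with (a ⇒ (a ⇒ a)).
  { apply derives_positive; [form_tac | constructor]. }
  apply d_mp with (a ⇒ ((a ⇒ a) ⇒ a));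
    apply derives_positive; try form_tac; constructor.
Qed.

Lemma deduction Γ a b :
  formula L a -> derives L (a :: Γ) b -> derives L Γ (a ⇒ b).
Proof.
  intros Fa; induction 1 as [b [<-|Hb] Fb|b Fb Sb|b c db IHb dbc IHbc].
  - now apply derives_refl.
  - apply derives_const; trivial; now apply d_hyp.
  - apply derives_const; trivial; now apply d_ax.
  - apply d_mp with (a ⇒ b); trivial.
    apply d_mp with (a ⇒ (b ⇒ c)); trivial.
    apply derives_formula in db; apply derives_formula in dbc.
    apply derives_positive; [form_tac | constructor].
Qed.

Lemma derives_Top Γ : derives L Γ ⊤.
Proof.
  apply d_mp with (⊤ ⇒ ⊤); [apply derives_refl, (formula_Top L PL)|].
  apply derives_positive; [pose proof (formula_Top L PL); form_tac | constructor].
Qed.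

Lemma derives_And Γ a b :
  derives L Γ a -> derives L Γ b -> derives L Γ (a ∧ b).
Proof.
  intros da db; pose proof (derives_formula _ _ da) as Fa.
  pose proof (derives_formula _ _ db) as Fb.
  pose proof (formula_Top L PL) as FT.
  (* (A6) only pairs consequences of a common premise; [⊤] serves as that premise. *)
  apply d_mp with ⊤; [apply derives_Top|].
  apply d_mp with (⊤ ⇒ b); [now apply derives_const|].
  apply d_mp with (⊤ ⇒ a); [now apply derives_const|].
  apply derives_positive; [form_tac | constructor].
Qed.

Lemma derives_And_l Γ a b : derives L Γ (a ∧ b) -> derives L Γ a.
Proof.
  intros d; pose proof (derives_formula _ _ d) as F; apply d_mp with (a ∧ b); trivial.
  apply derives_positive; [form_tac | constructor].
Qed.

Lemma derives_And_r Γ a b : derives L Γ (a ∧ b) -> derives L Γ b.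
Proof.
  intros d; pose proof (derives_formula _ _ d) as F; apply d_mp with (a ∧ b); trivial.
  apply derives_positive; [form_tac | constructor].
Qed.

Lemma derives_Or_l Γ a b : formula L b -> derives L Γ a -> derives L Γ (a ∨ b).
Proof.
  intros Fb d; pose proof (derives_formula _ _ d) as F; apply d_mp with a; trivial.
  apply derives_positive; [form_tac | constructor].
Qed.

End PositiveLogic.

Lemma ILM_positive : positive_logic ILM.
Proof. split; cbn; unfold ILM_formula; auto using ILM_scheme; tauto. Qed.

Lemma JP'_positive : positive_logic JP'.
Proof.
  split; cbn; auto using JP'_formula, JP'_scheme;
    intros a b; (split; [inversion 1; auto | intros []; now constructor]).
Qed.

(** * Derived rules of [ILM], and the axioms of [JP'] inside it *)

Lemma ILM_Neg_intro Γ a b :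
  derives ILM (a :: Γ) b -> derives ILM (a :: Γ) (¬ b) -> derives ILM Γ (¬ a).
Proof.
  intros db dnb.
  apply d_mp with (a ⇒ ¬ b); [now apply (deduction _ ILM_positive)|].
  apply d_mp with (a ⇒ b); [now apply (deduction _ ILM_positive)|].
  apply d_ax; [exact I | apply A9].
Qed.

Lemma ILM_Neg_elim Γ a b :
  derives ILM Γ a -> derives ILM Γ (¬ a) -> derives ILM Γ b.
Proof.
  intros da dna; apply d_mp with a; trivial; apply d_mp with (¬ a); trivial.
  apply d_ax; [exact I | apply A10].
Qed.

(** This is the right-to-left half of (A11) at [⊤], whose premise [⊤] is free. *)
Lemma ILM_SimTop_stable Γ : derives ILM Γ (¬ ¬ ∼ ⊤) -> derives ILM Γ (∼ ⊤).
Proof.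
  intros d; apply d_mp with (⊤ ⇒ ¬ ¬ ∼ ⊤).
  { now apply (derives_const _ ILM_positive). }
  eapply (derives_And_r _ ILM_positive), d_ax; [exact I | apply A11].
Qed.

Lemma ILM_Sim_intro Γ a : derives ILM (a :: Γ) (∼ ⊤) -> derives ILM Γ (∼ a).
Proof.
  intros d; apply d_mp with (a ⇒ ¬ ¬ ∼ ⊤).
  - apply (deduction _ ILM_positive); [exact I|].
    apply ILM_Neg_intro with (∼ ⊤).
    + apply derives_weaken with (a :: Γ); [apply incl_tl, incl_refl | trivial].
    + apply d_hyp; [now left | exact I].
  - eapply (derives_And_r _ ILM_positive), d_ax; [exact I | apply A11].
Qed.

Lemma ILM_Sim_elim Γ a :
  derives ILM Γ a -> derives ILM Γ (∼ a) -> derives ILM Γ (∼ ⊤).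
Proof.
  intros da dna; apply ILM_SimTop_stable, d_mp with a; trivial.
  apply d_mp with (∼ a); trivial.
  eapply (derives_And_l _ ILM_positive), d_ax; [exact I | apply A11].
Qed.

Local Ltac ILM_hyp := apply d_hyp; [cbn; tauto | exact I].

Lemma JP'_scheme_ILM Γ a : JP'_scheme a -> derives ILM Γ a.
Proof.
  intros [b Hb|b c|b].
  - apply d_ax; [exact I | now constructor].
  - do 2 (apply (deduction _ ILM_positive); [exact I|]).
    apply ILM_Sim_intro, ILM_Sim_elim with c; apply d_mp with b; ILM_hyp.
  (* By stability it is enough to refute [¬ ∼ ⊤]. Under that assumption [∼ ⊤ ⇒ b] holds by
     explosion, which together with the hypothesis [∼ (∼ ⊤ ⇒ b)] gives [∼ ⊤]. *)
  - apply ILM_Sim_intro, ILM_SimTop_stable, ILM_Neg_intro with (∼ ⊤); [|ILM_hyp].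
    apply ILM_Sim_elim with (∼ ⊤ ⇒ b); [|ILM_hyp].
    apply (deduction _ ILM_positive); [exact I|].
    apply ILM_Neg_elim with (∼ ⊤); ILM_hyp.
Qed.

(** * Derived rules of [JP'] *)

Lemma JP'_Sim_intro Γ a :
  JP'_formula a -> derives JP' (a :: Γ) (∼ ⊤) -> derives JP' Γ (∼ a).
Proof.
  intros Fa d; apply d_mp with (a ⇒ ∼ ⊤); [now apply (deduction _ JP'_positive)|].
  (* (A13) with [⊤] as its second formula. *)
  apply d_mp with (a ⇒ ⊤).
  - apply (derives_const _ JP'_positive), (derives_Top _ JP'_positive); trivial.
  - apply d_ax; [cbn; auto 8 using JP'_formula | apply A13].
Qed.

Lemma JP'_Sim_elim Γ a :
  derives JP' Γ a -> derives JP' Γ (∼ a) -> derives JP' Γ (∼ ⊤).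
Proof.
  intros da dna; pose proof (derives_formula _ JP'_positive _ _ da) as Fa; cbn in Fa.
  (* (A13) with [⊤] as its first formula, so both premises get the antecedent [⊤]. *)
  apply d_mp with (⊤ ⇒ ∼ a).
  { apply (derives_const _ JP'_positive); [constructor | trivial]. }
  apply d_mp with (⊤ ⇒ a).
  { apply (derives_const _ JP'_positive); [constructor | trivial]. }
  apply d_ax; [cbn; auto 8 using JP'_formula | apply A13].
Qed.

(** Discharging [∼ ⊤ ⇒ b] turns the premise into [∼ (∼ ⊤ ⇒ b)], which clashes with (P'). *)
Lemma JP'_Peirce Γ b :
  JP'_formula b -> derives JP' ((∼ ⊤ ⇒ b) :: Γ) (∼ ⊤) -> derives JP' Γ (∼ ⊤).
Proof.
  intros Fb d; apply JP'_Sim_elim with (∼ (∼ ⊤ ⇒ b)).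
  - apply JP'_Sim_intro; auto using JP'_formula.
  - apply d_ax; [cbn; auto using JP'_formula | apply P'].
Qed.

(** * The translation of [ILM] into [JP'] *)

Fixpoint bottom (N : nat) : form :=
  match N with
  | 0 => ∼ ⊤
  | S n => bottom n ∧ Var n
  end.

Fixpoint translate (N : nat) (a : form) : form :=
  match a with
  | Var n => if n <? N then Var n else ⊤
  | Top => ⊤
  | Bot => bottom N
  | And a b => translate N a ∧ translate N b
  | Or a b => translate N a ∨ translate N b
  | Imp a b => translate N a ⇒ translate N b
  | Neg a => translate N a ⇒ bottom N
  | Sim a => ∼ translate N a
  end.

Lemma bottom_formula N : JP'_formula (bottom N).
Proof. induction N; cbn; auto using JP'_formula. Qed.

Lemma translate_formula N a : JP'_formula (translate N a).
Proof.
  induction a as [n| | | | | | |]; cbn -[Nat.ltb]; auto using JP'_formula, bottom_formula.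
  destruct (n <? N); constructor.
Qed.

Lemma bottom_SimTop Γ N : derives JP' Γ (bottom N) -> derives JP' Γ (∼ ⊤).
Proof.
  induction N as [|N IH]; cbn; trivial.
  intros d; eapply IH, (derives_And_l _ JP'_positive), d.
Qed.

Lemma bottom_Var Γ N n :
  n < N -> derives JP' Γ (bottom N) -> derives JP' Γ (Var n).
Proof.
  induction N as [|N IH]; cbn; intros ltn d; [lia|].
  destruct (Nat.eq_dec n N) as [->|ne].
  - eapply (derives_And_r _ JP'_positive), d.
  - apply IH; [lia | eapply (derives_And_l _ JP'_positive), d].
Qed.

(** Variables below [N] are conjuncts of [bottom N] and the others become [⊤]. An implication or a
    translated negation follows from its consequent alone, and [∼] is introduced from [∼ ⊤], the
    innermost conjunct. *)
Lemma bottom_elim Γ N a :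
  derives JP' Γ (bottom N) -> derives JP' Γ (translate N a).
Proof.
  intros d; induction a as [n| | |a IHa b IHb|a IHa b IHb|a IHa b IHb|a IHa|a IHa];
    cbn -[Nat.ltb]; trivial.
  - destruct (Nat.ltb_spec n N); [now apply bottom_Var with N|].
    apply (derives_Top _ JP'_positive).
  - apply (derives_Top _ JP'_positive).
  - now apply (derives_And _ JP'_positive).
  - apply (derives_Or_l _ JP'_positive); trivial; apply translate_formula.
  - apply (derives_const _ JP'_positive); trivial; apply translate_formula.
  - apply (derives_const _ JP'_positive); trivial; apply translate_formula.
  - apply JP'_Sim_intro; [apply translate_formula|].
    apply bottom_SimTop with N.
    eapply derives_weaken, d; apply incl_tl, incl_refl.
Qed.

Lemma translate_positive N a : positive_scheme a -> positive_scheme (translate N a).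
Proof. intros []; constructor. Qed.

Local Ltac JP'_deduce := apply (deduction _ JP'_positive);
  [cbn; auto 8 using JP'_formula, bottom_formula, translate_formula|].

Local Ltac JP'_hyp := apply d_hyp;
  [cbn; tauto | cbn; auto 8 using JP'_formula, bottom_formula, translate_formula].

Lemma translate_ILM_scheme Γ N a :
  ILM_scheme a -> derives JP' Γ (translate N a).
Proof.
  intros [b Hb|b|b c|b c|b].
  - apply (derives_positive _ JP'_positive);
      [apply translate_formula | now apply translate_positive].
  - cbn; JP'_deduce; apply bottom_elim; JP'_hyp.
  - cbn; do 3 JP'_deduce.
    apply d_mp with (translate N c); apply d_mp with (translate N b); JP'_hyp.
  - cbn; do 2 JP'_deduce; apply bottom_elim.
    apply d_mp with (translate N b); JP'_hyp.
  - cbn; apply (derives_And _ JP'_positive).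
    + do 3 JP'_deduce; apply d_mp with (∼ ⊤); [|JP'_hyp].
      apply JP'_Sim_elim with (translate N b); JP'_hyp.
    (* Given the translation of [b], the hypothesis yields [(∼ ⊤ ⇒ bottom N) ⇒ bottom N]. The Peirce
       rule allows assuming [∼ ⊤ ⇒ bottom N] while proving [∼ ⊤]; this gives [bottom N], hence
       [∼ ⊤]. *)
    + JP'_deduce; apply JP'_Sim_intro; [apply translate_formula|].
      apply JP'_Peirce with (bottom N); [apply bottom_formula|].
      apply bottom_SimTop with N, d_mp with (∼ ⊤ ⇒ bottom N); [JP'_hyp|].
      apply d_mp with (translate N b); JP'_hyp.
Qed.

Lemma translate_provable N a : provable ILM a -> derives JP' [] (translate N a).
Proof.
  induction 1 as [a _ Sa|a b _ IHa _ IHab].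
  - now apply translate_ILM_scheme.
  - now apply d_mp with (translate N a).
Qed.

(** Asking for all [M] above a bound lets the bounds of two subformulas be merged, here by adding
    them. *)
Lemma translate_id a :
  JP'_formula a -> exists N, forall M, N <= M -> translate M a = a.
Proof.
  induction 1 as [n| |a b _ [N IHa] _ [K IHb]|a b _ [N IHa] _ [K IHb]
                 |a b _ [N IHa] _ [K IHb]|a _ [N IHa]]; cbn -[Nat.ltb].
  - exists (S n); intros M leM; destruct (Nat.ltb_spec n M); [trivial | lia].
  - now exists 0.
  - exists (N + K); intros M leM; rewrite IHa, IHb by lia; trivial.
  - exists (N + K); intros M leM; rewrite IHa, IHb by lia; trivial.
  - exists (N + K); intros M leM; rewrite IHa, IHb by lia; trivial.
  - exists N; intros M leM; rewrite IHa by lia; trivial.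
Qed.

Theorem theorem3p9 : is_extension_of ILM JP'.
Proof.
  split; [intros; exact I|].
  intros a Fa; split.
  - clear Fa; induction 1 as [a _ Sa|a b _ IHa _ IHab].
    + now apply derives_nil, JP'_scheme_ILM.
    + now apply prov_mp with a.
  - intros pa; destruct (translate_id a Fa) as [N HN].
    rewrite <- (HN N (le_n N)); now apply derives_nil, translate_provable.
Qed.
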